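(* Let $V$ be a vertex ring with Stone space $X$. Then the Pierce bundle $\mathcal{R}\to X$ of $V$ is a reduced étale bundle of vertex rings; that is, it is an étale bundle of vertex rings such that (i) $X$ is a Boolean space and (ii) each stalk is an indecomposable vertex ring.
   Context: A vertex ring is an additive abelian group $V$ with biadditive products $u(n)v$ for all $n\in\mathbf{Z}$ and a distinguished element $\mathbf{1}\in V$ (the vacuum) such that for all $u,v,w\in V$: (a) there is an integer $n_0(u,v)\ge 0$ with $u(n)v=0$ for all $n\ge n_0$; (b) $u(-1)\mathbf{1}=u$ and $u(n)\mathbf{1}=0$ for $n\ge 0$; (c) for all $r,s,t\in\mathbf{Z}$, $\sum_{i\ge 0}\binom{r}{i}(u(t+i)v)(r+s-i)w=\sum_{i\ge 0}(-1)^i\binom{t}{i}\{u(r+t-i)v(s+i)w-(-1)^t v(s+t-i)u(r+i)w\}$. Here $\binom{m}{n}=m(m-1)\cdots(m-n+1)/n!$ for $m\in\mathbf{Z}$, $n\ge 1$, and $\binom{m}{0}=1$. An idempotent of $V$ is $e\in V$ with $e(n)e=\delta_{n,-1}e$ for all $n\in\mathbf{Z}$; $V$ is indecomposable if its only idempotents are $0$ and $\mathbf{1}$. The set $B=B(V)$ of idempotents lies in the center $C(V)=\{u: u(n)=0\ \forall n\neq -1\}$, a commutative ring under $uv:=u(-1)v$, and $B$ is a Boolean ring with this multiplication and addition $e\oplus f:=e+f-2ef$. The Stone space of $V$ is $X=\mathrm{Spec}(B)$ (prime, equivalently maximal, ideals of $B$) with the Zariski topology; a basis is given by the sets $N(e)=\{M\in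 X: e\notin M\}$, $e\in B$. A Boolean space is a totally disconnected, compact Hausdorff space. For $M\in X$ set $\overline{M}:=\bigcup_{e\in M}e(-1)V$, a 2-sided ideal of $V$, so $V/\overline{M}$ is a vertex ring. The Pierce bundle of $V$ is $\pi:\mathcal{R}\to X$, where $\mathcal{R}$ is the disjoint union of the $V/\overline{M}$ ($M\in X$), $\pi(v+\overline{M})=M$, and $\mathcal{R}$ has the topology with basis the sets $\sigma_v(N(e))$, $v\in V$, $e\in B$, where $\sigma_v(M)=v+\overline{M}$. An étale bundle of vertex rings is a continuous surjection $p:E\to X$ that is a local homeomorphism ($E$ is covered by open sets mapped by $p$ homeomorphically onto open subsets of $X$), such that each stalk $E_x=p^{-1}(x)$ is a vertex ring, the maps $\Delta\to E$, $(t,u)\mapsto t-u$ and $(t,u)\mapsto t(n)u$ ($n\in\mathbf{Z}$) are continuous where $\Delta=\{(t,u)\in E\times E: p(t)=p(u)\}$, and the map $X\to E$ sending $x$ to the vacuum of $E_x$ is continuous. *)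

(* Defs.v *)
From HB Require Import structures.
From mathcomp Require Import all_boot all_order all_algebra.
From mathcomp Require Import boolp classical_sets functions cardinality fsbigop.
From mathcomp Require Import topology zify ring.

Set Implicit Arguments.
Unset Strict Implicit.
Unset Printing Implicit Defensive.

Import Order.TTheory GRing.Theory Num.Theory.

Local Open Scope classical_set_scope.
Local Open Scope ring_scope.

(* The quotient is exact. *)
Definition binz (m : int) (n : nat) : int :=
  ((\prod_(i < n) (m - i%:Z)) %/ (n`!)%:Z)%Z.

(* The two sums in [vprod_jacobi] have finite support by [vprod_trunc], so
   [\sum_(i \in _)] never takes its default value there. *)
HB.mixin Record isVertexRing V & GRing.Zmodule V := {
  vprod : int -> V -> V -> V;
  vacuum : V;
  vprod_addl : forall n u v w,
    vprod n (u + v) w = vprod n u w + vprod n v w;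
  vprod_addr : forall n u v w,
    vprod n u (v + w) = vprod n u v + vprod n u w;
  vprod_trunc : forall u v, exists n0 : nat,
    forall n : int, n0%:Z <= n -> vprod n u v = 0;
  vprod_vacuum : forall u, vprod (-1) u vacuum = u;
  vprod_vacuum0 : forall u (n : int), 0 <= n -> vprod n u vacuum = 0;
  vprod_jacobi : forall (r s t : int) u v w,
    \sum_(i \in [set: nat])
       vprod (r + s - i%:Z) (vprod (t + i%:Z) u v) w *~ binz r i
    = \sum_(i \in [set: nat])
       (vprod (r + t - i%:Z) u (vprod (s + i%:Z) v w)
        - vprod (s + t - i%:Z) v (vprod (r + i%:Z) u w) *~ (-1) ^ t)
       *~ ((-1) ^+ i * binz t i)
}.

#[short(type="vertexRingType")]
HB.structure Definition VertexRing := {V of isVertexRing V & GRing.Zmodule V}.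

Notation "u *_( n ) v" := (vprod n u v)
  (at level 40, n at level 200, left associativity,
   format "u  *_( n )  v") : ring_scope.

Definition is_idempotent (V : vertexRingType) (e : V) : Prop :=
  forall n : int, e *_(n) e = if n == -1 then e else 0.

Definition indecomposable (V : vertexRingType) : Prop :=
  forall e : V, is_idempotent e -> e = 0 \/ e = vacuum.

Definition central (V : vertexRingType) (u : V) : Prop :=
  forall (n : int) (v : V), n != -1 -> u *_(n) v = 0.

Lemma fsum0 (M : zmodType) (F : nat -> M) :
  (forall i, F i = 0) -> \sum_(i \in [set: nat]) F i = 0.
Proof. by move=> h; apply: fsbig1. Qed.

Lemma fsum_ord (M : zmodType) (N : nat) (F : nat -> M) :
  (forall i, (N <= i)%N -> F i = 0) ->
  \sum_(i \in [set: nat]) F i = \sum_(i < N) F i.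
Proof.
move=> h; rewrite fsbig_ord (fsbig_widen `I_N setT)//.
move=> i [_ /= /negP]; rewrite -leqNgt; exact: h.
Qed.

Lemma fsum_pt (M : zmodType) (k : nat) (F : nat -> M) :
  (forall i, i != k -> F i = 0) -> \sum_(i \in [set: nat]) F i = F k.
Proof.
move=> h; rewrite (@fsum_ord _ k.+1); last first.
  by move=> i ki; apply: h; rewrite gtn_eqF.
rewrite (bigD1 ord_max)//= big1 ?addr0// => i.
by rewrite -val_eqE; exact: h.
Qed.

Lemma binz0 m : binz m 0 = 1.
Proof. by rewrite /binz big_ord0. Qed.

Lemma binz_small (n i : nat) : (n < i)%N -> binz n i = 0.
Proof.
move=> ni; rewrite /binz (bigD1 (Ordinal ni))//= subrr mul0r; exact: div0z.
Qed.

Lemma binzN1 i : binz (-1) i = (-1) ^+ i.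
Proof.
rewrite /binz; suff -> : \prod_(j < i) (-1 - j%:Z) = (-1) ^+ i * (i`!)%:Z.
  by rewrite mulzK// eqz_nat -lt0n fact_gt0.
elim: i => [|i IH]; first by rewrite big_ord0.
rewrite big_ord_recr/= IH factS exprS PoszM -opprD -[1 + i%:Z]/(i.+1%:Z).
by ring.
Qed.

Section VertexRingTheory.
Variable V : vertexRingType.
Implicit Types (u v w e f : V) (n m r s t : int).

Lemma vprod0l n v : 0 *_(n) v = 0 :> V.
Proof. by apply: (addrI (0 *_(n) v)); rewrite -vprod_addl !addr0. Qed.

Lemma vprod0r n v : v *_(n) 0 = 0 :> V.
Proof. by apply: (addrI (v *_(n) 0)); rewrite -vprod_addr !addr0. Qed.

Lemma vprodNl n u v : (- u) *_(n) v = - (u *_(n) v).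
Proof. by apply: (addrI (u *_(n) v)); rewrite -vprod_addl !subrr vprod0l. Qed.

Lemma vprodNr n u v : u *_(n) (- v) = - (u *_(n) v).
Proof. by apply: (addrI (u *_(n) v)); rewrite -vprod_addr !subrr vprod0r. Qed.

Lemma vprodBl n u v w : (u - v) *_(n) w = u *_(n) w - v *_(n) w.
Proof. by rewrite vprod_addl vprodNl. Qed.

Lemma vprodBr n u v w : u *_(n) (v - w) = u *_(n) v - u *_(n) w.
Proof. by rewrite vprod_addr vprodNr. Qed.

Lemma vprod_comm u v : (forall n, 0 <= n -> u *_(n) v = 0) ->
  forall r s w, u *_(r) (v *_(s) w) = v *_(s) (u *_(r) w).
Proof.
move=> h r s w; have := vprod_jacobi r s 0 u v w.
rewrite fsum0; last by move=> i; rewrite add0r h// vprod0l mul0rz.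
rewrite (@fsum_pt _ 0) => [|[|i]//= _]; last by rewrite binz_small ?mulr0.
have e0 (x : int) : x - 0%:Z = x by rewrite subr0.
rewrite binz0 expr0 mulr1 expr0z !mulr1z !e0.
by move=> /esym/eqP; rewrite subr_eq0 => /eqP.
Qed.

Lemma vacuum_modes_central e :
  (forall n, n != -1 -> e *_(n) vacuum = 0) -> central e.
Proof.
move=> he.
have h v (k : nat) : e *_(k%:Z) v = 0.
  have [N hN] := vprod_trunc e v.
  have [m km] : exists m : nat, (N <= k + m)%N by exists N; exact: leq_addl.
  elim: m k km => [k|m IH k]; first by rewrite addn0 => km; exact: hN.
  move=> km; have hi (i : nat) : i != 0%N -> e *_(k%:Z + i%:Z) v = 0.
    case: i => // i _; have : (N <= (k + i.+1) + m)%N by lia.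
    exact: IH.
  have := vprod_jacobi (- k%:Z - 2) (k%:Z + 1) k%:Z e v vacuum.
  rewrite (@fsum_pt _ 0) => [|i i0]; last by rewrite hi// vprod0l mul0rz.
  rewrite binz0 mulr1z.
  rewrite [X in vprod X _ vacuum](_ : _ = -1); last by lia.
  rewrite vprod_vacuum [k%:Z + 0%:Z]addr0 => ->; apply: fsum0 => i.
  have si : 0 <= k%:Z + 1 + i%:Z by lia.
  rewrite (vprod_vacuum0 v _ si) vprod0r sub0r.
  have [ik|ik] := leqP i k.
    have ri : - k%:Z - 2 + i%:Z != -1 by apply/eqP; lia.
    by rewrite he// vprod0r mul0rz oppr0 mul0rz.
  by rewrite binz_small// mulr0.
have hc n v : 0 <= n -> e *_(n) v = 0 by case: n => // n _; exact: h.
move=> n v n1; rewrite -{1}(vprod_vacuum v).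
rewrite (vprod_comm (fun n => hc n v)) he//; exact: vprod0r.
Qed.

Lemma modes_vacuum_step e (m : nat) :
  (forall n, 0 <= n -> e *_(n) e = 0) -> e *_(-1) e = e ->
  (forall k : nat, (0 < k < m)%N -> e *_(-1 - k%:Z) vacuum = 0) ->
  (0 < m)%N -> e *_(-1 - m%:Z) vacuum = e *_(-1 - m%:Z) e *+ 2.
Proof.
case: m => // m e0 e1 hk _.
have := vprod_jacobi 0 (-1 - m.+1%:Z) (-1) e e vacuum.
rewrite (@fsum_pt _ 0) => [|i i0]; last first.
  by rewrite binz_small ?mulr0z// lt0n.
rewrite binz0 mulr1z [-1 + 0%:Z]addr0 e1
  [X in vprod X](_ : _ = -1 - m.+1%:Z); last by lia.
move=> ->; pose F i := e *_(-1 - i%:Z) (e *_(-1 - m.+1%:Z + i%:Z) vacuum).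
transitivity (\sum_(i \in [set: nat]) F i).
  apply: eq_fsbigr => i _.
  rewrite [e *_(0 + i%:Z) _]vprod_vacuum0 ?vprod0r; last lia.
  rewrite mul0rz subr0 binzN1 -exprMn mulrNN mulr1 expr1n mulr1z add0r.
  by [].
rewrite (@fsum_ord _ m.+2) => [|i mi]; last first.
  by rewrite /F vprod_vacuum0 ?vprod0r//; lia.
rewrite big_ord_recl big_ord_recr/= big1 => [|i _]; last first.
  rewrite /F /= /bump /=.
  have -> : -1 - m.+1%:Z + (1 + i)%N%:Z = -1 - (m - i)%N%:Z :> int.
    by have := ltn_ord i; lia.
  by rewrite hk ?vprod0r//; have := ltn_ord i; lia.
rewrite add0r mulr2n /F /= /bump/=; congr (_ + _).
  rewrite subr0 addr0 (vprod_comm e0) vprod_vacuum//.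
have -> : -1 - m.+1%:Z + (1 + m)%N%:Z = -1 :> int by lia.
by rewrite vprod_vacuum.
Qed.

Lemma modes_vacuum e : (forall n, 0 <= n -> e *_(n) e = 0) ->
  e *_(-1) e = e ->
  (forall k : nat, (0 < k)%N ->
    e *_(-1 - k%:Z) vacuum = e *_(-1 - k%:Z) e *+ 2 ->
    e *_(-1 - k%:Z) vacuum = 0) ->
  central e.
Proof.
move=> e0 e1 ek; apply: vacuum_modes_central => n n1.
have [n0|n0] := leP 0 n; first exact: vprod_vacuum0.
have [m m0 ->] : exists2 m : nat, (0 < m)%N & n = -1 - m%:Z.
  by exists `|(n + 1)%R|%N; lia.
elim/ltn_ind: m m0 => m IH m0.
apply: ek => //; apply: modes_vacuum_step => // k /andP[k0 km].
exact: IH.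
Qed.

Lemma idempotent_central e : is_idempotent e -> central e.
Proof.
move=> ee; apply: modes_vacuum => [n n0||k k0].
- by rewrite ee; case: eqP => // ?; lia.
- by rewrite ee eqxx.
- by rewrite ee; case: eqP => [|_ ->]; [lia|rewrite mul0rn].
Qed.

Lemma vacuum_central : central (vacuum : V).
Proof.
apply: modes_vacuum => [n n0||k k0].
- exact: vprod_vacuum0.
- exact: vprod_vacuum.
- by move/eqP; rewrite mulr2n -subr_eq0 opprD addrA subrr sub0r oppr_eq0
    => /eqP.
Qed.

Lemma central_commr e n m v w : central e ->
  v *_(n) (e *_(m) w) = e *_(m) (v *_(n) w).
Proof.
by move=> ce; rewrite -(vprod_comm (u := e))// => i i0; apply: ce; lia.
Qed.

Lemma central_comm e v : central e -> e *_(-1) v = v *_(-1) e.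
Proof.
by move=> ce; rewrite -{1}(vprod_vacuum v) -central_commr ?vprod_vacuum.
Qed.

Lemma central_prodl e n v w : central e ->
  (e *_(-1) v) *_(n) w = e *_(-1) (v *_(n) w).
Proof.
move=> ce; have := vprod_jacobi 0 n (-1) e v w.
rewrite (@fsum_pt _ 0) => [|i i0]; last by rewrite binz_small ?mulr0z// lt0n.
rewrite (@fsum_pt _ 0) => [|i i0]; last first.
  rewrite !ce ?vprod0r ?mul0rz ?subrr ?mul0rz//; apply/eqP; lia.
rewrite !binz0 expr0 mulr1 !mulr1z !addr0 [e *_(0) w]ce ?vprod0r//.
by rewrite mul0rz subr0 !add0r.
Qed.

Lemma vacuum_prod v : vacuum *_(-1) v = v.
Proof. by rewrite central_comm ?vprod_vacuum//; exact: vacuum_central. Qed.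

Lemma idempotent0 : is_idempotent (0 : V).
Proof. by move=> n; rewrite vprod0l if_same. Qed.

Lemma idempotent1 : is_idempotent (vacuum : V).
Proof.
move=> n; case: ifPn => [/eqP->|n1]; first exact: vprod_vacuum.
exact: vacuum_central.
Qed.

Lemma centralB u v : central u -> central v -> central (u - v).
Proof. by move=> cu cv n w n1; rewrite vprodBl cu ?cv ?subrr. Qed.

Lemma centralD u v : central u -> central v -> central (u + v).
Proof. by move=> cu cv n w n1; rewrite vprod_addl cu ?cv ?addr0. Qed.

Lemma centralM u v : central u -> central v -> central (u *_(-1) v).
Proof. by move=> cu cv n w n1; rewrite central_prodl// cv// vprod0r. Qed.

Lemma central_idem e : central e -> e *_(-1) e = e -> is_idempotent e.
Proof. by move=> ce ee n; case: ifPn => [/eqP->|]//; exact: ce. Qed.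

Lemma idem_idem e : is_idempotent e -> e *_(-1) e = e.
Proof. by move=> ->; rewrite eqxx. Qed.

End VertexRingTheory.

Section Center.
Variable V : vertexRingType.

Definition center_pred : {pred V} := fun u => `[< central u >].

Lemma center_predP u : reflect (central u) (u \in center_pred).
Proof. exact: asboolP. Qed.

Lemma center_zmod_closed : zmod_closed center_pred.
Proof.
split=> [|u v /center_predP cu /center_predP cv]; apply/center_predP.
  by move=> n v _; rewrite vprod0l.
exact: centralB.
Qed.

HB.instance Definition _ := GRing.isZmodClosed.Build V center_pred
  center_zmod_closed.

Record center := Center { center_val :> V; _ : center_val \in center_pred }.

HB.instance Definition _ := [isSub for center_val].
HB.instance Definition _ := [Choice of center by <:].
HB.instance Definition _ := [SubChoice_isSubZmodule of center by <:].

Lemma centerP (u : center) : central (val u).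
Proof. by case: u => u /= /center_predP. Qed.

Lemma center_mul_subproof (u v : center) : val u *_(-1) val v \in center_pred.
Proof. by apply/center_predP/centralM; exact: centerP. Qed.

Definition center_mul (u v : center) : center :=
  @Center (val u *_(-1) val v) (center_mul_subproof u v).

Definition center_one : center :=
  @Center vacuum (introT (center_predP _) (@vacuum_central V)).

Lemma center_mulA : associative center_mul.
Proof.
by move=> u v w; apply: val_inj; rewrite /= central_prodl//; exact: centerP.
Qed.

Lemma center_mulC : commutative center_mul.
Proof.
by move=> u v; apply: val_inj; rewrite /= central_comm//; exact: centerP.
Qed.

Lemma center_mul1 : left_id center_one center_mul.
Proof. by move=> u; apply: val_inj; exact: vacuum_prod. Qed.

Lemma center_mulDl : left_distributive center_mul +%R.
Proof. by move=> u v w; apply: val_inj; exact: vprod_addl. Qed.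

HB.instance Definition _ := GRing.Zmodule_isComPzRing.Build center
  center_mulA center_mulC center_mul1 center_mulDl.

End Center.

Section IdempotentRing.
Variable V : vertexRingType.

Definition idem_pred : {pred V} := fun e => `[< is_idempotent e >].

Record idem := Idem { idem_val :> V; _ : idem_val \in idem_pred }.

HB.instance Definition _ := [isSub for idem_val].
HB.instance Definition _ := [Choice of idem by <:].

Lemma idemP (e : idem) : is_idempotent (val e).
Proof. by case: e => e /= /asboolP. Qed.

Lemma idem_centerP (e : idem) : val e \in @center_pred V.
Proof. exact/center_predP/idempotent_central/idemP. Qed.

Definition idem_center (e : idem) : center V := Center (idem_centerP e).

Lemma idem_centerK (e : idem) : idem_center e * idem_center e = idem_center e.
Proof. by apply: val_inj => /=; exact/idem_idem/idemP. Qed.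

Lemma center_idem (u : center V) : u * u = u -> val u \in idem_pred.
Proof.
move=> uu; apply/asboolP/central_idem; first exact: centerP.
by have := f_equal (@center_val V) uu.
Qed.

Lemma idem_add_subproof (e f : idem) :
  val e + val f - (val e *_(-1) val f) *+ 2 \in idem_pred.
Proof.
set x := idem_center e; set y := idem_center f.
suff : val (x + y - (x * y) *+ 2) \in idem_pred by [].
apply: center_idem.
have xx : x * x = x by exact: idem_centerK.
have yy : y * y = y by exact: idem_centerK.
have -> : (x + y - (x * y) *+ 2) * (x + y - (x * y) *+ 2) =
  x * x + y * y + (x * y) *+ 2 - ((x * x) * y) *+ 4
  - ((y * y) * x) *+ 4 + ((x * x) * (y * y)) *+ 4 by ring.
by rewrite xx yy; ring.
Qed.

Definition idem_add (e f : idem) : idem :=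
  @Idem (val e + val f - (val e *_(-1) val f) *+ 2) (idem_add_subproof e f).

Definition idem_opp (e : idem) : idem := e.

Definition idem_zero : idem := @Idem 0 (introT (asboolP _) (@idempotent0 V)).

Definition idem_one : idem :=
  @Idem vacuum (introT (asboolP _) (@idempotent1 V)).

Lemma idem_mul_subproof (e f : idem) : val e *_(-1) val f \in idem_pred.
Proof.
suff : val (idem_center e * idem_center f) \in idem_pred by [].
by apply: center_idem; rewrite mulrACA !idem_centerK.
Qed.

Definition idem_mul (e f : idem) : idem :=
  @Idem (val e *_(-1) val f) (idem_mul_subproof e f).

Lemma idem_center_inj : injective idem_center.
Proof. by move=> e f [ef]; exact: val_inj. Qed.

Lemma idem_centerD e f : idem_center (idem_add e f) =
  idem_center e + idem_center f - (idem_center e * idem_center f) *+ 2.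
Proof. exact: val_inj. Qed.

Lemma idem_centerM e f :
  idem_center (idem_mul e f) = idem_center e * idem_center f.
Proof. exact: val_inj. Qed.

Lemma idem_center0 : idem_center idem_zero = 0.
Proof. exact: val_inj. Qed.

Lemma idem_center1 : idem_center idem_one = 1.
Proof. exact: val_inj. Qed.

Lemma idem_addA : associative idem_add.
Proof.
by move=> e f g; apply: idem_center_inj; rewrite !idem_centerD; ring.
Qed.

Lemma idem_addC : commutative idem_add.
Proof. by move=> e f; apply: idem_center_inj; rewrite !idem_centerD; ring. Qed.

Lemma idem_add0 : left_id idem_zero idem_add.
Proof.
by move=> e; apply: idem_center_inj; rewrite idem_centerD idem_center0; ring.
Qed.

Lemma idem_addN : left_inverse idem_zero idem_opp idem_add.
Proof.
move=> e; apply: idem_center_inj.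
by rewrite idem_centerD idem_centerK idem_center0; ring.
Qed.

HB.instance Definition _ := GRing.isZmodule.Build idem
  idem_addA idem_addC idem_add0 idem_addN.

Lemma idem_mulA : associative idem_mul.
Proof.
by move=> e f g; apply: idem_center_inj; rewrite !idem_centerM mulrA.
Qed.

Lemma idem_mulC : commutative idem_mul.
Proof. by move=> e f; apply: idem_center_inj; rewrite !idem_centerM mulrC. Qed.

Lemma idem_mul1 : left_id idem_one idem_mul.
Proof.
by move=> e; apply: idem_center_inj; rewrite idem_centerM idem_center1 mul1r.
Qed.

Lemma idem_mulDl : left_distributive idem_mul +%R.
Proof.
move=> e f g; apply: idem_center_inj; rewrite idem_centerD !idem_centerM.
rewrite mulrACA idem_centerK -[_ + _]/(idem_add e f) idem_centerD; ring.
Qed.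

HB.instance Definition _ := GRing.Zmodule_isComPzRing.Build idem
  idem_mulA idem_mulC idem_mul1 idem_mulDl.

Lemma idem_mulrr (e : idem) : e * e = e.
Proof. by apply: idem_center_inj; rewrite idem_centerM idem_centerK. Qed.

Lemma idem_addee (e : idem) : e + e = 0.
Proof. exact: idem_addN. Qed.

Lemma val_idemM (e f : idem) : val (e * f) = val e *_(-1) val f.
Proof. by []. Qed.

Lemma val_idem_join (e f : idem) :
  val (e + f + e * f) = val e + val f - val e *_(-1) val f.
Proof.
suff /(congr1 val) : idem_center (idem_add (idem_add e f) (idem_mul e f)) =
  idem_center e + idem_center f - idem_center e * idem_center f by [].
rewrite !idem_centerD idem_centerM.
set x := idem_center e; set y := idem_center f.
have xx : x * x = x by exact: idem_centerK.
have yy : y * y = y by exact: idem_centerK.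
have -> : (x + y - (x * y) *+ 2) * (x * y) =
  (x * x) * y + (y * y) * x - ((x * x) * (y * y)) *+ 2 by ring.
by rewrite xx yy; ring.
Qed.

End IdempotentRing.

(* [idealr_closed] and [prime_idealr_closed] of the library are stated for
   nontrivial rings only, while [idem V] is trivial when [V = 0]. *)
Record prime_ideal (R : comPzRingType) (P : set R) : Prop := PrimeIdeal {
  prime_ideal0 : P 0;
  prime_idealD : forall x y, P x -> P y -> P (x + y);
  prime_idealM : forall x y, P y -> P (x * y);
  prime_ideal1 : ~ P 1;
  prime_ideal_prime : forall x y, P (x * y) -> P x \/ P y
}.

Record stone (V : vertexRingType) := Stone {
  stone_ideal : set (idem V);
  stone_prime : prime_ideal stone_ideal
}.

HB.instance Definition _ (V : vertexRingType) := gen_eqMixin (stone V).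
HB.instance Definition _ (V : vertexRingType) := gen_choiceMixin (stone V).

Definition stone_basic (V : vertexRingType) (e : idem V) : set (stone V) :=
  [set M : stone V | ~ stone_ideal M e].

Definition stone_base (V : vertexRingType) : set (set (stone V)) :=
  [set stone_basic e | e in [set: idem V]].

Arguments stone_base : clear implicits.

Lemma stone_base_cover (V : vertexRingType) :
  \bigcup_(A in stone_base V) A = setT.
Proof.
rewrite -subTset => M _; exists (stone_basic 1); first by exists 1.
exact: prime_ideal1 (stone_prime M).
Qed.

Lemma stone_base_join (V : vertexRingType) (A B : set (stone V)) M :
  stone_base V A -> stone_base V B -> A M -> B M ->
  exists C, [/\ stone_base V C, C M & C `<=` A `&` B].
Proof.
move=> [e _ <-] [f _ <-] eM fM; exists (stone_basic (e * f)); split.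
- by exists (e * f).
- by move=> /(prime_ideal_prime (stone_prime M))[].
- move=> N efN; split=> ?; apply: efN.
    by rewrite mulrC; exact: (prime_idealM (stone_prime N)).
  exact: (prime_idealM (stone_prime N)).
Qed.

HB.instance Definition _ (V : vertexRingType) :=
  isBaseTopological.Build (stone V) (@stone_base_cover V) (@stone_base_join V).

HB.mixin Record isVertexIdeal (V : vertexRingType) (I : {pred V}) := {
  vertex_ideal_prodl : forall (n : int) (u v : V), u \in I -> u *_(n) v \in I;
  vertex_ideal_prodr : forall (n : int) (u v : V), v \in I -> u *_(n) v \in I
}.

#[short(type="vertexIdeal")]
HB.structure Definition VertexIdeal (V : vertexRingType) :=
  {I of GRing.ZmodClosed V I & isVertexIdeal V I}.

Lemma fsum_raddf (M N : zmodType) (g : {additive M -> N}) (F : nat -> M) :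
  (exists n0 : nat, forall i, (n0 <= i)%N -> F i = 0) ->
  g (\sum_(i \in [set: nat]) F i) = \sum_(i \in [set: nat]) g (F i).
Proof.
move=> [n0 F0]; rewrite (fsum_ord F0) raddf_sum (@fsum_ord _ n0)// => i ni.
by rewrite F0// raddf0.
Qed.

Section JacobiSupport.
Variables (V : vertexRingType) (r s t : int) (u v w : V).

Lemma vprod_shift (a : int) (x y : V) : exists n0 : nat,
  forall i, (n0 <= i)%N -> x *_(a + i%:Z) y = 0.
Proof.
have [N hN] := vprod_trunc x y; exists (N + absz a)%N => i ni; apply: hN; lia.
Qed.

Lemma jacobi_supportl : exists n0 : nat, forall i, (n0 <= i)%N ->
  vprod (r + s - i%:Z) (vprod (t + i%:Z) u v) w *~ binz r i = 0.
Proof.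
have [N hN] := vprod_shift t u v; exists N => i ni.
by rewrite hN// vprod0l mul0rz.
Qed.

Lemma jacobi_supportr : exists n0 : nat, forall i, (n0 <= i)%N ->
  (vprod (r + t - i%:Z) u (vprod (s + i%:Z) v w)
   - vprod (s + t - i%:Z) v (vprod (r + i%:Z) u w) *~ (-1) ^ t)
  *~ ((-1) ^+ i * binz t i) = 0.
Proof.
have [N hN] := vprod_shift s v w; have [N' hN'] := vprod_shift r u w.
exists (N + N')%N => i ni.
have iN : (N <= i)%N by lia.
have iN' : (N' <= i)%N by lia.
rewrite hN// hN'//.
by rewrite !vprod0r mul0rz subr0 mul0rz.
Qed.
End JacobiSupport.

Section VertexQuotient.
Local Open Scope quotient_scope.
Variables (V : vertexRingType) (I : vertexIdeal V).

Definition vquot := {ideal_quot I}.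

HB.instance Definition _ := GRing.Zmodule.on vquot.
HB.instance Definition _ := EqQuotient.on vquot.

Definition vquot_pi (v : V) : vquot := \pi_{ideal_quot I} v.

Lemma vquot_pi_zmod_morphism : zmod_morphism vquot_pi.
Proof. exact: raddfB. Qed.

HB.instance Definition _ := GRing.isZmodMorphism.Build V vquot vquot_pi
  vquot_pi_zmod_morphism.

Lemma vquot_piP u v : reflect (vquot_pi u = vquot_pi v) (u - v \in I).
Proof. by rewrite Quotient.idealrBE; exact: eqP. Qed.

Lemma vquot_piK (x : vquot) : vquot_pi (repr x) = x.
Proof. exact: reprK. Qed.

Definition vquot_vacuum : vquot := vquot_pi vacuum.

Definition vquot_prod (n : int) (x y : vquot) : vquot :=
  vquot_pi (repr x *_(n) repr y).

Lemma vquot_piM n u v :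
  vquot_prod n (vquot_pi u) (vquot_pi v) = vquot_pi (u *_(n) v).
Proof.
have E (z : V) : repr (vquot_pi z) - z \in I.
  by apply/vquot_piP; exact: vquot_piK.
apply/vquot_piP; rewrite /vquot_prod.
move: (repr _) (E u) (repr _) (E v) => u' uu' v' vv'.
have -> : u' *_(n) v' - u *_(n) v = (u' - u) *_(n) v' + u *_(n) (v' - v).
  by rewrite vprodBl vprodBr addrA subrK.
by apply: rpredD; [exact: vertex_ideal_prodl | exact: vertex_ideal_prodr].
Qed.

Lemma vquot_ind (P : vquot -> Prop) :
  (forall v, P (vquot_pi v)) -> forall x, P x.
Proof. by move=> h x; rewrite -(vquot_piK x). Qed.

Lemma vquot_addl n u v w :
  vquot_prod n (u + v) w = vquot_prod n u w + vquot_prod n v w.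
Proof.
elim/vquot_ind: u => u; elim/vquot_ind: v => v; elim/vquot_ind: w => w.
by rewrite -raddfD !vquot_piM -raddfD vprod_addl.
Qed.

Lemma vquot_addr n u v w :
  vquot_prod n u (v + w) = vquot_prod n u v + vquot_prod n u w.
Proof.
elim/vquot_ind: u => u; elim/vquot_ind: v => v; elim/vquot_ind: w => w.
by rewrite -raddfD !vquot_piM -raddfD vprod_addr.
Qed.

Lemma vquot_trunc u v : exists n0 : nat,
  forall n : int, n0%:Z <= n -> vquot_prod n u v = 0.
Proof.
elim/vquot_ind: u => u; elim/vquot_ind: v => v.
have [N hN] := vprod_trunc u v; exists N => n Nn.
by rewrite vquot_piM hN// raddf0.
Qed.

Lemma vquot_prod_vacuum u : vquot_prod (-1) u vquot_vacuum = u.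
Proof. by elim/vquot_ind: u => u; rewrite vquot_piM vprod_vacuum. Qed.

Lemma vquot_prod_vacuum0 u (n : int) :
  0 <= n -> vquot_prod n u vquot_vacuum = 0.
Proof.
by elim/vquot_ind: u => u n0; rewrite vquot_piM vprod_vacuum0// raddf0.
Qed.

Lemma vquot_jacobi (r s t : int) u v w :
  \sum_(i \in [set: nat])
     vquot_prod (r + s - i%:Z) (vquot_prod (t + i%:Z) u v) w *~ binz r i
  = \sum_(i \in [set: nat])
     (vquot_prod (r + t - i%:Z) u (vquot_prod (s + i%:Z) v w)
      - vquot_prod (s + t - i%:Z) v (vquot_prod (r + i%:Z) u w) *~ (-1) ^ t)
     *~ ((-1) ^+ i * binz t i).
Proof.
elim/vquot_ind: u => u; elim/vquot_ind: v => v; elim/vquot_ind: w => w.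
have := congr1 vquot_pi (vprod_jacobi r s t u v w).
rewrite (fsum_raddf _ (jacobi_supportl r s t u v w)).
rewrite (fsum_raddf _ (jacobi_supportr r s t u v w)) => h.
rewrite [LHS](eq_fsbigr (fun i => vquot_pi (vprod (r + s - i%:Z)
  (vprod (t + i%:Z) u v) w *~ binz r i))); last first.
  by move=> i _; rewrite !vquot_piM raddfMz.
rewrite h; apply: eq_fsbigr => i _.
by rewrite raddfMz raddfB raddfMz !vquot_piM.
Qed.

HB.instance Definition _ := isVertexRing.Build vquot
  vquot_addl vquot_addr vquot_trunc vquot_prod_vacuum vquot_prod_vacuum0
  vquot_jacobi.

End VertexQuotient.

Section PierceIdeal.
Variables (V : vertexRingType) (M : stone V).

Definition pierce_ideal : {pred V} := fun v =>
  v \in \bigcup_(e in stone_ideal M) [set val e *_(-1) w | w in [set: V]].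

Lemma pierce_idealP v :
  reflect (exists2 e, stone_ideal M e & exists w, v = val e *_(-1) w)
          (v \in pierce_ideal).
Proof.
apply: (iffP idP) => [|[e Me [w ->]]]; rewrite unfold_in.
  by move=> /set_mem[e Me [w _ <-]]; exists e => //; exists w.
by apply/mem_set; exists e => //; exists w.
Qed.

Lemma pierce_ideal_zmod_closed : zmod_closed pierce_ideal.
Proof.
have MP := stone_prime M.
split=> [|u v /pierce_idealP[e Me [x ->]] /pierce_idealP[f Mf [y ->]]].
  apply/pierce_idealP; exists 0; first exact: prime_ideal0.
  by exists 0; rewrite vprod0r.
apply/pierce_idealP; exists (e + f + e * f).
  by do !apply: (prime_idealD MP) => //; exact: prime_idealM.
exists (val e *_(-1) x - val f *_(-1) y).
have ce := idempotent_central (idemP e).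
have cf := idempotent_central (idemP f).
set A := val e *_(-1) x; set B := val f *_(-1) y.
have eA : val e *_(-1) A = A.
  by rewrite -central_prodl// idem_idem//; exact: idemP.
have fB : val f *_(-1) B = B.
  by rewrite -central_prodl// idem_idem//; exact: idemP.
rewrite val_idem_join vprodBl vprod_addl !vprodBr !central_prodl//.
rewrite eA fB (central_commr _ _ _ _ cf) eA.
by rewrite opprB addrAC !subrKA.
Qed.

HB.instance Definition _ := GRing.isZmodClosed.Build V pierce_ideal
  pierce_ideal_zmod_closed.

Lemma pierce_ideal_prodl (n : int) (u v : V) :
  u \in pierce_ideal -> u *_(n) v \in pierce_ideal.
Proof.
move=> /pierce_idealP[e Me [w ->]]; apply/pierce_idealP; exists e => //.
exists (w *_(n) v); rewrite central_prodl//.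
exact/idempotent_central/idemP.
Qed.

Lemma pierce_ideal_prodr (n : int) (u v : V) :
  v \in pierce_ideal -> u *_(n) v \in pierce_ideal.
Proof.
move=> /pierce_idealP[e Me [w ->]]; apply/pierce_idealP; exists e => //.
exists (u *_(n) w); rewrite central_commr//.
exact/idempotent_central/idemP.
Qed.

HB.instance Definition _ := isVertexIdeal.Build V pierce_ideal
  pierce_ideal_prodl pierce_ideal_prodr.

Definition pierce_stalk : vertexRingType := vquot pierce_ideal.

End PierceIdeal.

Section PierceTotal.
Variable V : vertexRingType.

Definition pierce_total : Type := {M : stone V & pierce_stalk M}.

HB.instance Definition _ := gen_eqMixin pierce_total.
HB.instance Definition _ := gen_choiceMixin pierce_total.

Definition pierce_section (v : V) (M : stone V) : pierce_total :=
  existT (@pierce_stalk V) M (vquot_pi (pierce_ideal M) v).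

Definition pierce_base : set (set pierce_total) :=
  [set A | exists v e, A = pierce_section v @` stone_basic e].

Lemma pierce_section_tagged v M z : pierce_section v M = z ->
  tagged z = vquot_pi (pierce_ideal (tag z)) v.
Proof. by move=> <-. Qed.

Lemma pierce_base_cover : \bigcup_(A in pierce_base) A = setT.
Proof.
rewrite -subTset => -[M a] _; elim/vquot_ind: a => v.
exists (pierce_section v @` stone_basic 1); first by exists v, 1.
by exists M => //; exact: prime_ideal1 (stone_prime M).
Qed.

Lemma pierce_base_join A B z : pierce_base A -> pierce_base B -> A z -> B z ->
  exists C, [/\ pierce_base C, C z & C `<=` A `&` B].
Proof.
move=> [v [e ->]] [w [f ->]] [M eM <-] [M' fM' h].
have MM' : M' = M.
  by rewrite -[M']/(tag (pierce_section w M')) h.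
have /esym/vquot_piP/pierce_idealP[g Mg [x vwE]] := pierce_section_tagged h.
rewrite {}MM' in fM' => {h}; have MP := stone_prime M.
exists (pierce_section v @` stone_basic (e * f * (1 + g))).
split; first by exists v, (e * f * (1 + g)).
- exists M => // /(prime_ideal_prime MP)[/(prime_ideal_prime MP)[]//|gM].
  apply: (prime_ideal1 MP).
  have -> : 1 = (1 + g) + g :> idem V by rewrite -addrA idem_addee addr0.
  exact: prime_idealD.
- move=> _ [N hN <-]; have NP := stone_prime N; split.
    exists N => // eN; apply: hN; rewrite -mulrA mulrC.
    exact: prime_idealM.
  exists N => [fN|].
    by apply: hN; rewrite mulrAC; exact: prime_idealM.
  congr existT; apply/vquot_piP/pierce_idealP; exists g; last by exists x.
  have : stone_ideal N (g * (1 + g)).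
    rewrite mulrDr mulr1 idem_mulrr idem_addee; exact: prime_ideal0.
  move=> /(prime_ideal_prime NP)[]// gN; exfalso; apply: hN.
  exact: prime_idealM.
Qed.

HB.instance Definition _ :=
  isBaseTopological.Build pierce_total pierce_base_cover pierce_base_join.

End PierceTotal.

(* The stalk over [x] is the fibre of the projection; the type [stalk x]
   carries its vertex ring structure through the bijection [stalk_incl]. *)
Record vertex_bundle (X : topologicalType) := VertexBundle {
  bundle_total : topologicalType;
  bundle_proj : bundle_total -> X;
  stalk : X -> vertexRingType;
  stalk_incl : forall x, stalk x -> bundle_total;
  stalk_incl_bij : forall x,
    set_bij [set: stalk x] (bundle_proj @^-1` [set x]) (@stalk_incl x)
}.

Section EtaleBundle.
Variables (X : topologicalType) (E : vertex_bundle X).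

Definition stalk_coord (x : X) : bundle_total E -> stalk E x :=
  'pinv_(fun=> 0) setT (@stalk_incl X E x).

Lemma stalk_inclK x : cancel (@stalk_incl X E x) (stalk_coord x).
Proof.
have [_ inj _] := @stalk_incl_bij X E x.
by move=> a; rewrite /stalk_coord pinvKV ?inE.
Qed.

Definition fibre_product : set (bundle_total E * bundle_total E) :=
  [set tu | bundle_proj tu.1 = bundle_proj tu.2].

(* Only the values on [fibre_product] are meaningful. *)
Definition stalkwise (op : forall x, stalk E x -> stalk E x -> stalk E x)
    (tu : bundle_total E * bundle_total E) : bundle_total E :=
  let x := bundle_proj tu.1 in
  stalk_incl (op x (stalk_coord x tu.1) (stalk_coord x tu.2)).

Definition maps_homeomorphically (U : set (bundle_total E)) (W : set X) : Prop :=
  exists s : X -> bundle_total E,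
    [/\ set_fun U W (@bundle_proj X E), set_fun W U s,
        {in U, cancel (@bundle_proj X E) s} & {in W, cancel s (@bundle_proj X E)}] /\
    {within U, continuous (@bundle_proj X E)} /\ {within W, continuous s}.

Record etale_bundle : Prop := EtaleBundle {
  etale_proj_continuous : continuous (@bundle_proj X E);
  etale_proj_surj : set_surj setT setT (@bundle_proj X E);
  etale_local_homeo : forall z : bundle_total E, exists U W,
    [/\ open U, U z, open W & maps_homeomorphically U W];
  etale_sub_continuous :
    {within fibre_product, continuous (stalkwise (fun x t u => t - u))};
  etale_prod_continuous : forall n : int,
    {within fibre_product, continuous (stalkwise (fun x t u => t *_(n) u))};
  etale_vacuum_continuous :
    continuous (fun x => stalk_incl (vacuum : stalk E x))
}.

End EtaleBundle.

Definition boolean_space (X : topologicalType) : Prop :=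
  [/\ totally_disconnected [set: X], compact [set: X] & hausdorff_space X].

Definition reduced_etale_bundle (X : topologicalType) (E : vertex_bundle X) :
    Prop :=
  [/\ etale_bundle E, boolean_space X & forall x, indecomposable (stalk E x)].

Section PierceBundle.
Variable V : vertexRingType.

Definition pierce_incl (M : stone V) (a : pierce_stalk M) : pierce_total V :=
  existT (@pierce_stalk V) M a.

Lemma pierce_incl_bij (M : stone V) :
  set_bij [set: pierce_stalk M] (@tag _ (@pierce_stalk V) @^-1` [set M])
          (@pierce_incl M).
Proof.
split=> [a _|a b _ _ ab|[N a] /= NM]; first by [].
  by have := eq_from_Tagged ab.
by move: a; rewrite NM => a; exists a.
Qed.

Definition pierce_bundle : vertex_bundle (stone V) :=
  @VertexBundle (stone V) (pierce_total V) (@tag _ (@pierce_stalk V))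
    (@pierce_stalk V) pierce_incl pierce_incl_bij.

End PierceBundle.

(* Main.v *)
(** Everything topological reduces to the remark that if two global sections
    [v], [w] agree at [M], then [v - w = g(-1)x] with [g] in [M], so they agree
    on the whole neighbourhood [N(1 + g)] of [M].  Compactness of the Stone
    space: along an ultrafilter [F], the [e] such that [e] belongs to [F]-almost
    every [M] form a prime ideal, to which [F] converges.  For the stalks, an
    idempotent of [V / Mbar] is lifted to an idempotent of [V].  This looks like
    infinitely many conditions [v(n)v = 0], but those with [n >= 0] and
    [v(-1)v = v] imply all others, and only finitely many of them are
    nontrivial, so one element of [M] kills all the obstructions. *)
From mathcomp Require Import all_boot all_algebra.
From mathcomp Require Import boolp classical_sets functions topology.
Require Import Defs.

Set Implicit Arguments.
Unset Strict Implicit.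
Unset Printing Implicit Defensive.

Import GRing.Theory.

Local Open Scope classical_set_scope.
Local Open Scope ring_scope.

(** * Idempotents and their Boolean complements *)

Section Idempotents.
Variable V : vertexRingType.
Implicit Types (e f : idem V) (v w : V).

(** Put [y = v(-1-k)1] and [z = v(-1-k)v]. Since [v(n)v = 0] for [n >= 0], the modes of [v] commute,
    so [v(-1)] sends both [y] and [z] to [z]. Applied to the relation [y = 2z] supplied by
    [modes_vacuum], it gives [z = 2z], hence [y = 0]. *)
Lemma idempotentP v :
  is_idempotent v <->
  (forall n : nat, v *_(n%:Z) v = 0) /\ v *_(-1) v = v.
Proof.
split=> [vi|[v0 v1]]; first by split=> [n|]; rewrite vi.
have {}v0 (n : int) : 0 <= n -> v *_(n) v = 0 by case: n.
apply: central_idem => //; apply: modes_vacuum => // k _ yE.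
have eyE : v *_(-1) (v *_(-1 - k%:Z) vacuum) = v *_(-1 - k%:Z) v.
  by rewrite (vprod_comm v0) vprod_vacuum.
have eeyE : v *_(-1) (v *_(-1 - k%:Z) v) = v *_(-1 - k%:Z) v.
  by rewrite (vprod_comm v0) v1.
suff ev0 : v *_(-1 - k%:Z) v = 0 by rewrite yE ev0 mul0rn.
have := eyE; rewrite yE mulr2n vprod_addr eeyE => /eqP.
by rewrite -subr_eq0 addrK => /eqP.
Qed.

Lemma idem_mulC1r e : e * (1 + e) = 0.
Proof. by rewrite mulrDr mulr1 idem_mulrr idem_addee. Qed.

Lemma idem_add11 e : (1 + e) + e = 1.
Proof. by rewrite -addrA idem_addee addr0. Qed.

Lemma val_idem_add1 e : val (1 + e) = vacuum - val e.
Proof.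
rewrite [LHS](_ : _ = vacuum + val e - (vacuum *_(-1) val e) *+ 2)//.
by rewrite vacuum_prod mulr2n opprD addrA addrK.
Qed.

End Idempotents.

(** * The Stone space is Boolean *)

Section StoneSpace.
Variable V : vertexRingType.
Implicit Types (M N : stone V) (e f g : idem V).

Lemma stone_inj M N : stone_ideal M = stone_ideal N -> M = N.
Proof.
case: M N => [I hI] [J hJ] /= IJ; subst J.
by congr Stone; exact: Prop_irrelevance.
Qed.

(** From [e * (1 + e) = 0] and [(1 + e) + e = 1]. This is what makes the basic open sets closed as
    well. *)
Lemma stone_ideal_add1 M e : stone_ideal M (1 + e) <-> ~ stone_ideal M e.
Proof.
have MP := stone_prime M; split=> [e1 e0|ne].
  by apply: (prime_ideal1 MP); rewrite -(idem_add11 e); exact: prime_idealD.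
have : stone_ideal M (e * (1 + e)) by rewrite idem_mulC1r; exact: prime_ideal0.
by move=> /(prime_ideal_prime MP)[].
Qed.

Lemma stone_basic_setC e : ~` stone_basic e = stone_basic (1 + e).
Proof.
by apply/seteqP; split=> M; rewrite /stone_basic/= stone_ideal_add1.
Qed.

Lemma nbhs_stoneP M (A : set (stone V)) :
  nbhs M A <-> exists2 e, ~ stone_ideal M e & stone_basic e `<=` A.
Proof.
split=> [[_ [[D DB <-] [_ /[dup] /DB [e _ <-] De Me] DA]]|[e Me eA]].
  by exists e => // N Ne; apply: DA; exists (stone_basic e).
exists (stone_basic e); split=> //.
exists [set stone_basic e] => [_ -> |]; first by exists e.
by rewrite bigcup_set1.
Qed.

Lemma open_stone_basic e : open (stone_basic e).
Proof. by rewrite openE => M Me; apply/nbhs_stoneP; exists e. Qed.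

Lemma clopen_stone_basic e : clopen (stone_basic e).
Proof.
split; first exact: open_stone_basic.
rewrite -[stone_basic e]setCK stone_basic_setC.
exact/open_closedC/open_stone_basic.
Qed.

Lemma stone_zero_dimensional : zero_dimensional (stone V).
Proof.
have sep M N e : stone_ideal M e -> ~ stone_ideal N e ->
    exists U, [/\ clopen U, U M & ~ U N].
  move=> Me Ne; exists (stone_basic (1 + e)); split.
  - exact: clopen_stone_basic.
  - by rewrite -stone_basic_setC.
  - by rewrite -stone_basic_setC.
move=> M N MN.
have [e] : exists e, ~ (stone_ideal M e <-> stone_ideal N e).
  apply/existsNP => eqMN; move/eqP: MN; apply; apply/stone_inj/seteqP.
  by split=> e /eqMN.
have [Me|Me] := pselect (stone_ideal M e).
  have [Ne|Ne _] := pselect (stone_ideal N e); first by tauto.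
  exact: sep Me Ne.
have [Ne _|Ne] := pselect (stone_ideal N e); last by tauto.
(* [sep] is one-sided: here it yields a clopen set around [N], whose complement is the one
   wanted. *)
have [U [Uc UN UM]] := sep _ _ _ Ne Me.
by exists (~` U); split => //; exact: clopenC.
Qed.

Lemma stone_hausdorff : hausdorff_space (stone V).
Proof.
rewrite open_hausdorff => M N /stone_zero_dimensional[U [[oU cU] UM UN]].
exists (U, ~` U) => /=; first by rewrite !inE.
by split=> //; [exact: closed_openC|rewrite setICr].
Qed.

Lemma ultra_prime_ideal (F : set_system (stone V)) : UltraFilter F ->
  prime_ideal [set e | F [set M | stone_ideal M e]].
Proof.
move=> FU; have FP := @ultra_proper _ _ FU; split=> /=.
- by apply: filterE => M; exact: (prime_ideal0 (stone_prime M)).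
- move=> e f; apply: filterS2 => M; exact: (prime_idealD (stone_prime M)).
- move=> e f; apply: filterS => M; exact: (prime_idealM (stone_prime M)).
- by move=> /filter_ex[M]; exact: (prime_ideal1 (stone_prime M)).
(* Primality uses that [F] is an ultrafilter: if [e] is not in almost every [M], it is missing from
   almost every [M], and these must contain [f]. *)
- move=> e f Fef; have [|nFe] := in_ultra_setVsetC [set M | stone_ideal M e] FU.
    by left.
  right; apply: filterS2 nFe Fef => M nMe /(prime_ideal_prime (stone_prime M)).
  by case.
Qed.

Lemma stone_compact : compact [set: stone V].
Proof.
rewrite compact_ultra => F FU _; have FP := @ultra_proper _ _ FU.
exists (Stone (ultra_prime_ideal FU)); split=> // A /nbhs_stoneP[e /= Fe eA].
apply: filterS eA _.
by have [] := in_ultra_setVsetC [set M | stone_ideal M e] FU.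
Qed.

Lemma stone_boolean : boolean_space (stone V).
Proof.
split; [|exact: stone_compact|exact: stone_hausdorff].
exact/zero_dimension_totally_disconnected/stone_zero_dimensional.
Qed.

End StoneSpace.

(** * Lifting idempotents and indecomposability of the stalks *)

Section Stalks.
Variables (V : vertexRingType) (M : stone V).

Lemma pierce_ideal_idem (e : idem V) :
  stone_ideal M e -> val e \in pierce_ideal M.
Proof.
move=> Me; apply/pierce_idealP; exists e => //.
by exists vacuum; rewrite vprod_vacuum.
Qed.

(** Each element of the ideal is fixed by some [e] in [M]. The Boolean join [g + e + g * e] is
    [1 - (1 - g)(1 - e)] in the center, so it fixes whatever [g] or [e] fixes; induction then
    handles a finite list. *)
Lemma pierce_ideal_unit (s : seq V) : {subset s <= pierce_ideal M} ->
  exists2 g : idem V, stone_ideal M g & {in s, forall a, val g *_(-1) a = a}.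
Proof.
have MP := stone_prime M.
elim: s => [_|a s IH sM]; first by exists 0; first exact: prime_ideal0.
have [b bs|g Mg gs] := IH; first by apply: sM; rewrite inE bs orbT.
have /pierce_idealP[e Me [x aE]] : a \in pierce_ideal M.
  by apply: sM; rewrite mem_head.
have ce := idempotent_central (idemP e).
have cg := idempotent_central (idemP g).
exists (g + e + g * e).
  by do !apply: (prime_idealD MP) => //; exact: prime_idealM.
have eaE : val e *_(-1) a = a.
  by rewrite aE -central_prodl// idem_idem//; exact: idemP.
move=> b; rewrite inE val_idem_join vprodBl vprod_addl central_prodl//.
case/predU1P => [->|/gs gb]; first by rewrite eaE addrAC subrr add0r.
by rewrite (central_commr _ _ _ _ ce) gb addrK.
Qed.

Lemma pierce_stalk_idem_lift (x : pierce_stalk M) : is_idempotent x ->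
  exists e : idem V, vquot_pi (pierce_ideal M) (val e) = x.
Proof.
elim/vquot_ind: x => v /idempotentP[v0 v1].
have vprodE n : vprod n (vquot_pi (pierce_ideal M) v) (vquot_pi _ v) =
  vquot_pi (pierce_ideal M) (v *_(n) v) by exact: vquot_piM.
have [n0 hn0] := vprod_trunc v v.
(* The finitely many obstructions to [v] being idempotent; all vanish in the stalk, so a single [g]
   in [M] fixes them. *)
have [|g Mg gs] := @pierce_ideal_unit
    (v *_(-1) v - v :: [seq v *_(i%:Z) v | i <- iota 0 n0]).
  move=> a; rewrite inE => /predU1P[->|/mapP[i _ ->]].
    by apply/vquot_piP; rewrite -vprodE.
  by rewrite -[X in X \in _]subr0; apply/vquot_piP; rewrite -vprodE v0 raddf0.
have cc := idempotent_central (idemP (1 + g)).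
have kill a : val g *_(-1) a = a -> val (1 + g) *_(-1) a = 0.
  by rewrite val_idem_add1 vprodBl vacuum_prod => ->; rewrite subrr.
(* Cutting [v] by the central idempotent [1 + g] multiplies every [v(n)v] by [1 + g], which kills
   what [g] fixes. *)
have vE n : (val (1 + g) *_(-1) v) *_(n) (val (1 + g) *_(-1) v) =
    val (1 + g) *_(-1) (v *_(n) v).
  rewrite central_prodl// (central_commr _ _ _ _ cc) -central_prodl//.
  by rewrite idem_idem//; exact: idemP.
have ei : is_idempotent (val (1 + g) *_(-1) v).
  apply/idempotentP; split=> [n|]; rewrite vE.
    have [nn0|nn0] := ltnP n n0; last by rewrite hn0 ?vprod0r// lez_nat.
    apply/kill/gs; rewrite inE; apply/orP; right; apply/mapP; exists n => //.
    by rewrite mem_iota.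
  apply/eqP; rewrite -subr_eq0 -vprodBr; apply/eqP/kill/gs.
  by rewrite mem_head.
exists (Idem (introT (asboolP _) ei)); apply/vquot_piP.
rewrite -[val (Idem _)]/(val (1 + g) *_(-1) v).
(* The lift differs from [v] by [- g(-1)v], which lies in the ideal. *)
rewrite val_idem_add1 vprodBl vacuum_prod addrAC subrr add0r rpredN.
by apply: pierce_ideal_prodl; exact: pierce_ideal_idem.
Qed.

Lemma pierce_stalk_indecomposable : indecomposable (pierce_stalk M).
Proof.
move=> x /pierce_stalk_idem_lift[e <-].
(* Either [e] or [1 + e], that is [vacuum - e], lies in [M]. *)
have [Me|/stone_ideal_add1 Me] := pselect (stone_ideal M e); [left|right].
  rewrite -[RHS](raddf0 (vquot_pi (pierce_ideal M))).
  by apply/vquot_piP; rewrite subr0; exact: pierce_ideal_idem.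
apply/esym/vquot_piP; rewrite -val_idem_add1; exact: pierce_ideal_idem.
Qed.

End Stalks.

(** * Étale structure of the Pierce bundle *)

Section Bundle.
Variable V : vertexRingType.
Implicit Types (M N : stone V) (v w : V).

Lemma pierce_sectionP (z : pierce_total V) :
  exists v, z = pierce_section v (tag z).
Proof. by case: z => M a; elim/vquot_ind: a => v; exists v. Qed.

Lemma pierce_section_near v w M :
  pierce_section v M = pierce_section w M ->
  \forall N \near M, pierce_section v N = pierce_section w N.
Proof.
move=> /esym/pierce_section_tagged/vquot_piP/pierce_idealP[g Mg [x vwE]].
apply/nbhs_stoneP; exists (1 + g) => [/stone_ideal_add1//|N].
rewrite -stone_basic_setC => /contrapT Ng.
congr existT; apply/vquot_piP/pierce_idealP.
by exists g => //; exists x.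
Qed.

(** Transfers all continuity questions to the Stone space. A basic set through this point comes from
    some section [w] that agrees with [v] at [M], hence near [M]. *)
Lemma nbhs_pierce_totalP v M (A : set (pierce_total V)) :
  nbhs (pierce_section v M) A <->
  \forall N \near M, A (pierce_section v N).
Proof.
split=> [[_ [[D DB <-] [_ /[dup] /DB [w [e ->]] De [N Ne wvE]] DA]]|].
  have NM : N = M by exact: (congr1 tag wvE).
  rewrite {}NM in Ne wvE.
  have eM : nbhs M (stone_basic e) by apply/nbhs_stoneP; exists e.
  apply: filterS2 eM (pierce_section_near wvE) => N' eN' <-; apply: DA.
  by exists (pierce_section w @` stone_basic e) => //; exists N'.
move=> /nbhs_stoneP[e Me eA].
exists (pierce_section v @` stone_basic e); split.
- exists [set pierce_section v @` stone_basic e]; last by rewrite bigcup_set1.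
  by move=> _ ->; exists v, e.
- by exists M.
- by move=> _ [N eN <-]; exact: eA.
Qed.

Lemma pierce_section_continuous v : continuous (pierce_section v).
Proof. by move=> M A /nbhs_pierce_totalP. Qed.

Lemma pierce_proj_continuous :
  continuous (@tag _ (@pierce_stalk V) : pierce_total V -> stone V).
Proof.
move=> z A /= zA; have [v zE] := pierce_sectionP z.
by rewrite zE; apply/nbhs_pierce_totalP.
Qed.

Lemma open_range_pierce_section v : open (range (pierce_section v)).
Proof.
rewrite openE => _ [M _ <-]; apply/nbhs_pierce_totalP.
by apply: filterE => N; exists N.
Qed.

Lemma pierce_range_homeo v :
  @maps_homeomorphically _ (pierce_bundle V) (range (pierce_section v)) setT.
Proof.
exists (pierce_section v); split; last first.
  by split; apply: continuous_subspaceT;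
    [exact: pierce_proj_continuous|exact: pierce_section_continuous].
split=> // z.
by rewrite inE => -[M _ <-].
Qed.

(* Over [N], the operation carries [(v, w)] to the value at [N] of one global
   section [op v w]. *)
Lemma pierce_stalkwise_continuous (op : V -> V -> V)
    (opM : forall M, pierce_stalk M -> pierce_stalk M -> pierce_stalk M) :
  (forall M v w, opM M (vquot_pi _ v) (vquot_pi _ w) = vquot_pi _ (op v w)) ->
  {within fibre_product (E := pierce_bundle V),
    continuous (stalkwise (E := pierce_bundle V) opM)}.
Proof.
move=> opE; have stalkwiseE v w M :
    stalkwise (E := pierce_bundle V) opM
      (pierce_section v M, pierce_section w M) = pierce_section (op v w) M.
  have coordE (N : stone V) (a : pierce_stalk N) :
      stalk_coord (E := pierce_bundle V) N (existT _ N a) = a.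
    exact: (@stalk_inclK _ (pierce_bundle V)).
  by rewrite /stalkwise/= !coordE opE.
apply/subspace_continuousP => -[t u] /=; rewrite /fibre_product/=.
have [v ->] := pierce_sectionP t; have [w ->] := pierce_sectionP u.
move: (tag t) (tag u) => M _ /= <- A.
rewrite /from_subspace stalkwiseE.
move=> /nbhs_pierce_totalP MA.
(* Restricting to the images of the two sections; the condition on [A] is needed in one factor only,
   since both base points agree on the fibre product. *)
exists ([set z | z = pierce_section v (tag z) /\
                 A (pierce_section (op v w) (tag z))],
        [set z | z = pierce_section w (tag z)]) => /=.
  by split; apply/nbhs_pierce_totalP => //=; [apply: filterS MA|apply: filterE].
move=> [t' u'] /= [[tE +] uE] tu.
by rewrite -stalkwiseE -tE [X in pierce_section w X]tu -uE.
Qed.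

Lemma pierce_etale : etale_bundle (pierce_bundle V).
Proof.
split.
- exact: pierce_proj_continuous.
- by move=> M _; exists (pierce_section 0 M).
- move=> z; have [v zE] := pierce_sectionP z.
  exists (range (pierce_section v)), setT; split.
  + exact: open_range_pierce_section.
  + by rewrite zE; exists (tag z).
  + exact: openT.
  + exact: pierce_range_homeo.
- apply: (pierce_stalkwise_continuous (op := fun v w => v - w)) => M v w.
  by rewrite raddfB.
- move=> n; apply: (pierce_stalkwise_continuous (op := vprod n)) => M v w.
  exact: vquot_piM.
(* The vacuum of each stalk is the class of [vacuum], so this map is a global section. *)
- exact: pierce_section_continuous.
Qed.

End Bundle.

Theorem corollary9p14 (V : vertexRingType) :
  reduced_etale_bundle (pierce_bundle V).
Proof.
split; [exact: pierce_etale|exact: stone_boolean|].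
exact: pierce_stalk_indecomposable.
Qed.
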